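(* Let $d\ge1$, and let $f:\mathbb{R}\to\mathbb{R}$ be continuous with $f(0)=0$, $f(x)\ge0$ for $x\ge0$, and $$\liminf_{\eta\to\infty}\left(f(\eta)\,e^{-\lambda\eta^p}\right)>0$$ for some $\lambda>0$ and $p>1$. Then there exists $u_0\in\exp L^p(\mathbb{R}^d)$ with $u_0\ge0$ such that for every $T>0$ the Cauchy problem $$\partial_tu+(-\Delta+|x|^2)u=f(u),\qquad u(x,0)=u_0(x),$$ has no nonnegative $\exp L^p$-classical solution on $[0,T)$.
   Context: For $1\le p<\infty$, $\exp L^p(\mathbb{R}^d)$ is the space of $u\in L^1_{loc}(\mathbb{R}^d)$ with $\int_{\mathbb{R}^d}(e^{|u(x)|^p/\mu^p}-1)\,dx<\infty$ for some $\mu>0$, with the Luxemburg norm $\|u\|_{\exp L^p}=\inf\{\mu>0:\int_{\mathbb{R}^d}(e^{|u(x)|^p/\mu^p}-1)\,dx\le1\}$. For $p>1$ the weak$^\star$ topology on $\exp L^p(\mathbb{R}^d)$ is the one coming from its predual, the Orlicz space $L^{\psi^*}(\mathbb{R}^d)$ where $\psi(s)=e^{s^p}-1$ and $\psi^*(r)=\sup_{s\ge0}(rs-\psi(s))$: $u(t)\to u_0$ weak$^\star$ means $\int u(t)\varphi\,dx\to\int u_0\varphi\,dx$ for every $\varphi\in L^{\psi^*}(\mathbb{R}^d)$. Given $u_0\in\exp L^p(\mathbb{R}^d)$ and $T>0$, a function $u\in C((0,T];\exp L^p(\mathbb{R}^d))\cap L^\infty_{loc}(0,T;L^\infty(\mathbb{R}^d))$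 is an $\exp L^p$-classical solution of the Cauchy problem if $u\in C^{1,2}((0,T)\times\mathbb{R}^d)$ ($C^1$ in $t$, $C^2$ in $x$), $u$ satisfies the equation in the classical sense, and $u(t)\to u_0$ in the weak$^\star$ topology as $t\to0$. (Since the theorem is asserted for every $T>0$, it makes no difference whether the time interval is taken closed or open at $T$.) *)

(* Defs.v *)
From HB Require Import structures.
From mathcomp Require Import all_boot all_order all_algebra.
From mathcomp Require Import all_classical all_reals all_analysis.

Set Implicit Arguments.
Unset Strict Implicit.
Unset Printing Implicit Defensive.

Import Order.TTheory GRing.Theory Num.Theory.
Import numFieldNormedType.Exports.

Local Open Scope classical_set_scope.
Local Open Scope ring_scope.

(* R^d is 'rV[R]_d.  Its library topology (sup norm) is the Euclidean one; its
   sigma-algebra, generated by the coordinates, is the Borel one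
   (open_measurable_rV below). *)
Definition measure_rV_display : measure_display -> measure_display.
Proof. exact. Qed.

Section measurable_rV.
Context {R : realType}.
Variable n : nat.

Definition coord_rV (i : 'I_n) (x : 'rV[R]_n) : R := x ord0 i.

Let rV_set0 : g_sigma_preimage coord_rV set0.
Proof. exact: sigma_algebra0. Qed.

Let rV_setC A : g_sigma_preimage coord_rV A -> g_sigma_preimage coord_rV (~` A).
Proof. exact: sigma_algebraC. Qed.

Let rV_bigcup (F : _^nat) : (forall i, g_sigma_preimage coord_rV (F i)) ->
  g_sigma_preimage coord_rV (\bigcup_i (F i)).
Proof. exact: sigma_algebra_bigcup. Qed.

HB.instance Definition _ := @isMeasurable.Build
  (measure_rV_display default_measure_display)
  'rV[R]_n (g_sigma_preimage coord_rV) rV_set0 rV_setC rV_bigcup.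

Lemma measurable_coord_rV (i : 'I_n) :
  measurable_fun [set: 'rV[R]_n] (coord_rV i).
Proof.
move=> _ Y mY; rewrite setTI; apply: sub_sigma_algebra => /=.
rewrite -bigcup_seq/=; exists i => /=; first by rewrite mem_index_enum.
by exists Y => //; rewrite setTI.
Qed.

Lemma measurable_fun_rVP d1 (T1 : measurableType d1) (f : T1 -> 'rV[R]_n) :
  measurable_fun [set: T1] f <->
  forall i, measurable_fun [set: T1] (coord_rV i \o f).
Proof.
split=> [mf i|mf].
  by apply: measurableT_comp => //; exact: measurable_coord_rV.
have : g_sigma_preimage (fun i => coord_rV i \o f) `<=` measurable.
  apply: smallest_sub; first exact: sigma_algebra_measurable.
  rewrite -bigcup_seq => A [i _ [B mB <-]].
  exact: mf.
rewrite g_sigma_preimage_comp => prefS _ A mA.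
by apply: prefS; exists A.
Qed.

Lemma open_measurable_rV (U : set 'rV[R]_n) : open U -> measurable U.
Proof.
move=> oU.
pose box (ab : 'rV[rat]_n * 'rV[rat]_n) : set 'rV[R]_n :=
  [set x | forall i, ratr (ab.1 ord0 i) < x ord0 i < ratr (ab.2 ord0 i)].
have mbox ab : measurable (box ab).
  rewrite (_ : box ab = \bigcap_(i in [set` predT])
      (coord_rV i @^-1` `]ratr (ab.1 ord0 i), ratr (ab.2 ord0 i)[)); last first.
    apply/seteqP; split=> x /=; first by move=> bx i _ /=; rewrite in_itv/=.
    by move=> bx i; have /= := bx i isT; rewrite in_itv.
  apply: fin_bigcap_measurable; first exact: finite_finset.
  move=> i _; rewrite -[X in measurable X]setTI.
  by apply: measurable_coord_rV => //; exact: measurable_itv.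
rewrite (_ : U = \bigcup_(ab in [set ab | box ab `<=` U]) box ab); last first.
  apply/seteqP; split=> [x Ux|x [ab /= abU]]; last exact: abU.
  have /nbhs_ballP[e /= e0 eU] : nbhs x U by exact: open_nbhs_nbhs.
  have A i : exists ab : rat * rat,
      [/\ x ord0 i - e < ratr ab.1, ratr ab.1 < x ord0 i,
          x ord0 i < ratr ab.2 & ratr ab.2 < x ord0 i + e].
    have [|a] := @rat_in_itvoo R (x ord0 i - e) (x ord0 i).
      by rewrite ltrBlDr ltrDl.
    have [|b] := @rat_in_itvoo R (x ord0 i) (x ord0 i + e).
      by rewrite ltrDl.
    by rewrite !in_itv/= => /andP[? ?] /andP[? ?]; exists (a, b).
  have [g gP] := choice A.
  exists (\row_i (g i).1, \row_i (g i).2); last first.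
    by move=> i; rewrite !mxE; have [_ -> ->] := gP i.
  move=> y /= By; apply: eU; split => // j i.
  rewrite (ord1 j); have := By i; rewrite !mxE /ball/= => /andP[ay yb].
  have [xa _ _ bx] := gP i.
  by rewrite ltr_distlC (lt_trans xa ay) (lt_trans yb bx).
rewrite bigcup_mkcond; apply: countable_bigcupT_measurable => // ab.
by case: ifP.
Qed.

End measurable_rV.

Section lebesgue_rV.
Context {R : realType}.

Definition cons_rV n (z : measurableTypeR R * 'rV[R]_n) : 'rV[R]_n.+1 :=
  row_mx (const_mx z.1 : 'rV_1) z.2.

Lemma cons_rV0 n (z : measurableTypeR R * 'rV[R]_n) :
  cons_rV z ord0 ord0 = z.1.
Proof.
transitivity (cons_rV z ord0 (lshift n (ord0 : 'I_1))).
  by congr (cons_rV z ord0); exact/val_inj.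
by rewrite [LHS]row_mxEl mxE.
Qed.

Lemma cons_rVS n (z : measurableTypeR R * 'rV[R]_n) (i : 'I_n) :
  cons_rV z ord0 (lift ord0 i) = z.2 ord0 i.
Proof.
transitivity (cons_rV z ord0 (rshift 1 i)).
  by congr (cons_rV z ord0); exact/val_inj.
exact: row_mxEr.
Qed.

Lemma measurable_cons_rV n : measurable_fun [set: _] (@cons_rV n).
Proof.
apply/measurable_fun_rVP => i.
have [j ->|->] := unliftP ord0 i.
  rewrite (_ : _ \o _ = coord_rV j \o snd).
    apply: measurableT_comp; first exact: measurable_coord_rV.
    exact: measurable_snd.
  by apply/funext => z; rewrite /= /coord_rV cons_rVS.
rewrite (_ : _ \o _ = fst); first exact: measurable_fst.
by apply/funext => z; rewrite /= /coord_rV cons_rV0.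
Qed.

Local Open Scope ereal_scope.

Section lebesgue_cons.
Variables (n : nat) (m : {sigma_finite_measure set 'rV[R]_n -> \bar R}).

Definition lebesgue_cons : set 'rV[R]_n.+1 -> \bar R :=
  pushforward (lebesgue_measure \x m) (@cons_rV n).

Let lebesgue_cons0 : lebesgue_cons set0 = 0.
Proof. by rewrite /lebesgue_cons /pushforward preimage_set0 measure0. Qed.

Let lebesgue_cons_ge0 A : 0 <= lebesgue_cons A.
Proof. by rewrite /lebesgue_cons /pushforward measure_ge0. Qed.

Let lebesgue_cons_sigma_additive : semi_sigma_additive lebesgue_cons.
Proof.
have mf := @measurable_cons_rV n.
exact: (@measure_semi_sigma_additive _ _ _ (pushforward (lebesgue_measure \x m) (@cons_rV n))).
Qed.

HB.instance Definition _ := isMeasure.Build _ _ _ lebesgue_cons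
  lebesgue_cons0 lebesgue_cons_ge0 lebesgue_cons_sigma_additive.

Let lebesgue_cons_sigma_finite : sigma_finite setT lebesgue_cons.
Proof.
have /sigma_finiteP[F [TF ndF Foo]] :=
  sigma_finiteT (@lebesgue_measure R : {sigma_finite_measure set _ -> \bar R}).
have /sigma_finiteP[G [TG ndG Goo]] := sigma_finiteT m.
pose uncons (x : 'rV[R]_n.+1) : measurableTypeR R * 'rV[R]_n :=
  (x ord0 ord0, \row_i x ord0 (lift ord0 i)).
have muncons : measurable_fun setT uncons.
  apply/measurable_fun_pairP; split; first exact: measurable_coord_rV.
  apply/measurable_fun_rVP => i.
  rewrite (_ : _ \o _ = coord_rV (lift ord0 i)); first exact: measurable_coord_rV.
  by apply/funext => x; rewrite /= /coord_rV mxE.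
have unconsK z : uncons (cons_rV z) = z.
  case: z => a v; congr pair; first exact: cons_rV0.
  by apply/rowP => i; rewrite mxE cons_rVS.
exists (fun k => uncons @^-1` (F k `*` G k)).
  rewrite -preimage_bigcup (_ : \bigcup_k _ = setT) ?preimage_setT//.
  rewrite -subTset => -[x y] _.
  have [j _ Fx] : (\bigcup_k F k) x by rewrite -TF.
  have [k _ Gy] : (\bigcup_k G k) y by rewrite -TG.
  exists (maxn j k) => //; split.
    by move: x Fx; exact/subsetPset/ndF/leq_maxl.
  by move: y Gy; exact/subsetPset/ndG/leq_maxr.
move=> k; have [mF Fk] := Foo k; have [mG Gk] := Goo k; split.
  by rewrite -[X in measurable X]setTI; apply: muncons => //; exact: measurableX.
rewrite /lebesgue_cons /pushforward (_ : _ @^-1` _ = F k `*` G k); last first.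
  by apply/seteqP; split=> z; rewrite /preimage /mkset unconsK.
by rewrite product_measure1E// lte_mul_pinfty// ge0_fin_numE.
Qed.

HB.instance Definition _ := Measure_isSigmaFinite.Build _ _ _ lebesgue_cons
  lebesgue_cons_sigma_finite.

End lebesgue_cons.

Fixpoint lebesgue_rV (n : nat) : {sigma_finite_measure set 'rV[R]_n -> \bar R} :=
  if n is n'.+1 then lebesgue_cons (lebesgue_rV n') else \d_(0%R : 'rV[R]_0).

Lemma lebesgue_rV_prod n (A : 'I_n -> set R) :
  (forall i, measurable (A i)) ->
  lebesgue_rV n [set x | forall i, A i (x ord0 i)] =
  \prod_(i < n) lebesgue_measure (A i).
Proof.
elim: n A => [|n IHn] A mA.
  by rewrite big_ord0 /= diracE mem_set// => -[].
rewrite big_ord_recl -IHn//= /lebesgue_cons /pushforward.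
rewrite (_ : _ @^-1` _ = A ord0 `*`
    [set x : 'rV[R]_n | forall i, A (lift ord0 i) (x ord0 i)]); last first.
  apply/seteqP; split=> [z /= zA|z /= [z0 zA] i].
    by split=> [|i]; [rewrite -cons_rV0|rewrite -cons_rVS].
  by have [j ->|->] := unliftP ord0 i; [rewrite cons_rVS|rewrite cons_rV0].
rewrite product_measure1E//; first exact: mA.
have -> : [set x : 'rV[R]_n | forall i, A (lift ord0 i) (x ord0 i)] =
    \bigcap_(i in [set: 'I_n]) (coord_rV i @^-1` A (lift ord0 i)).
  by apply/seteqP; split=> x xA; [move=> i _; exact: xA|move=> i; exact: xA].
apply: fin_bigcap_measurable => [|i _]; first exact: finite_finset.
rewrite -[X in measurable X]setTI; exact: measurable_coord_rV.
Qed.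

End lebesgue_rV.

Section exp_Lebesgue.
Context {R : realType} {d : nat}.
Implicit Types (p mu : R) (u v phi : 'rV[R]_d -> R).

Local Notation leb := (lebesgue_rV d).

(* The members of the function spaces below are Borel representatives of
   classes modulo null sets. *)
Definition L1_loc u : Prop :=
  measurable_fun setT u /\
  forall K : set 'rV[R]_d, compact K -> (\int[leb]_(x in K) `|u x|%:E < +oo)%E.

Definition exp_modular p mu u : \bar R :=
  (\int[leb]_x (expR (`|u x| `^ p / mu `^ p) - 1)%:E)%E.

Definition expL p u : Prop :=
  L1_loc u /\ exists2 mu, 0 < mu & (exp_modular p mu u < +oo)%E.

(* Equal to +oo when no mu qualifies. *)
Definition expL_norm p u : \bar R :=
  ereal_inf [set mu%:E | mu in [set mu | 0 < mu /\ (exp_modular p mu u <= 1)%E]].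

Definition psi p (s : R) : R := expR (s `^ p) - 1.

Definition psi_conj p (r : R) : \bar R :=
  ereal_sup [set (r * s - psi p s)%:E | s in [set s | 0 <= s]].

Definition Lpsi_conj p phi : Prop :=
  measurable_fun setT phi /\
  exists2 k, 0 < k & (\int[leb]_x psi_conj p (`|phi x| / k) < +oo)%E.

Definition weak_star_cvg0 p (u : R -> 'rV[R]_d -> R) (u0 : 'rV[R]_d -> R) :
    Prop :=
  forall phi, Lpsi_conj p phi ->
  (\int[leb]_x (u t x * phi x)%:E)%E @[t --> 0^'+] -->
  (\int[leb]_x (u0 x * phi x)%:E)%E.

End exp_Lebesgue.

Section classical_solution.
Context {R : realType} {d : nat}.
Implicit Types (p T : R) (u : R -> 'rV[R]_d -> R).

Definition basis_rV (i : 'I_d) : 'rV[R]_d := delta_mx ord0 i.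

Definition laplacian (v : 'rV[R]_d -> R) (x : 'rV[R]_d) : R :=
  \sum_(i < d) 'D_(basis_rV i) ('D_(basis_rV i) v) x.

(* |x|^2 for the Euclidean norm; the library norm on 'rV is the sup norm. *)
Definition sqnorm (x : 'rV[R]_d) : R := \sum_(i < d) x ord0 i ^+ 2.

Definition continuous_expL p T u : Prop :=
  (forall t, t \in `]0, T] -> expL p (u t)) /\
  (forall t0, t0 \in `]0, T] ->
    expL_norm p (fun x => u t x - u t0 x) @[t --> within `]0, T] (nbhs t0)]
      --> 0%E).

Definition Linfty_loc T u : Prop :=
  forall a b, 0 < a -> a <= b -> b < T ->
  exists M : R, {ae lebesgue_measure, forall t : R, t \in `[a, b] ->
    (Lnorm (lebesgue_rV d) +oo (EFin \o u t) <= M%:E)%E}.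

Definition continuous_strip T (v : R -> 'rV[R]_d -> R) : Prop :=
  forall (t : R) (x : 'rV[R]_d), t \in `]0, T[ ->
  {for (t, x), continuous (fun z : R * 'rV[R]_d => v z.1 z.2)}.

Definition C12 T u : Prop :=
  [/\ forall t x, t \in `]0, T[ -> derivable (u ^~ x) t 1,
      forall t x i, t \in `]0, T[ -> derivable (u t) x (basis_rV i)
    & forall t x i j, t \in `]0, T[ ->
        derivable ('D_(basis_rV i) (u t)) x (basis_rV j)] /\
  [/\ continuous_strip T u,
      continuous_strip T (fun t x => 'D_1 (u ^~ x) t),
      forall i, continuous_strip T (fun t => 'D_(basis_rV i) (u t))
    & forall i j, continuous_strip T
        (fun t => 'D_(basis_rV j) ('D_(basis_rV i) (u t)))].

Definition expL_classical_solution (f : R -> R) p T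
    (u0 : 'rV[R]_d -> R) u : Prop :=
  [/\ continuous_expL p T u,
      Linfty_loc T u,
      C12 T u,
      forall t x, t \in `]0, T[ ->
        'D_1 (u ^~ x) t + (- laplacian (u t) x + sqnorm x * u t x) = f (u t x)
    & weak_star_cvg0 p u u0].

End classical_solution.

(* Main.v *)
Require Import Defs.
From mathcomp Require Import all_boot all_order all_algebra.
From mathcomp Require Import all_classical all_reals all_analysis.
From mathcomp Require Import measurable_realfun ring lra.

(* Test functions on the cubes [0, 1/k]^d shrinking to the singularity of
   u0(x) = 3 ((4/lambda) log_+ (1/|x|))^(1/p), |x| the sup norm, suffice.
   Let phi be the product of the bumps g(x_i), g(s) = (k s (1 - k s))^2, for
   which g'' >= - 18 k^2 g, and put m(t) = int u(t) phi, I = int phi.  Integrating by parts,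
   m' >= - K m + int f(u) phi with K = d (18 k^2 + 1).  Put
   eta = ((4/lambda) log k)^(1/p), so that u0 >= 3 eta on the cube.  For large
   k, the growth of f gives f(y) >= 2 K (y - eta) for all y >= 0, because
   exp (lambda eta^p / 2) = k^2, hence m' >= K (m - 2 eta I).  Weak*
   convergence yields m(s) >= 2 eta I for some small s, and this persists:
   m(T/2) >= 2 eta I.  But u(T/2) is continuous, hence bounded near 0 by some M,
   so 2 eta <= M, whereas eta -> +oo as k -> +oo. *)

Set Implicit Arguments.
Unset Strict Implicit.
Unset Printing Implicit Defensive.

Import Order.TTheory GRing.Theory Num.Theory.
Import numFieldNormedType.Exports.

Local Open Scope classical_set_scope.
Local Open Scope ring_scope.

(** * Row vectors and boxes *)

Lemma continuous_at_pairr (T1 T2 U : topologicalType) (f : T1 * T2 -> U) s y :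
  {for (s, y), continuous f} -> {for y, continuous (fun y => f (s, y))}.
Proof.
apply: (@continuous_comp _ _ _ (fun y => (s, y)) f).
by apply: cvg_pair => //=; exact: cvg_cst.
Qed.

Lemma continuous_at_pairl (T1 T2 U : topologicalType) (f : T1 * T2 -> U) s y :
  {for (s, y), continuous f} -> {for s, continuous (fun s => f (s, y))}.
Proof.
apply: (@continuous_comp _ _ _ (fun s => (s, y)) f).
by apply: cvg_pair => //=; exact: cvg_cst.
Qed.
Section row_vectors.
Context {R : realType}.

Lemma continuous_rV (T : topologicalType) n (F : T -> 'rV[R]_n) (x : T) :
  (forall i, continuous_at x (fun y => F y ord0 i)) ->
  continuous_at x F.
Proof.
move=> cF; apply/cvg_ballP => e e0.
have : \forall y \near x, forall i, ball (F x ord0 i) e (F y ord0 i).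
  by apply: filter_forall => i; move: e e0; apply/cvg_ballP; exact: cF.
by apply: filterS => y Fy; split => // i j; rewrite (ord1 i).
Qed.

Lemma continuous_cons_rV n :
  continuous (@cons_rV R n : R * 'rV[R]_n -> 'rV[R]_n.+1).
Proof.
move=> z; apply: continuous_rV => i.
have [j ->|->] := unliftP ord0 i.
  rewrite (_ : (fun _ => _) = (fun M : 'rV_n => M ord0 j) \o snd); last first.
    by apply/funext => y; exact: (@cons_rVS R).
  by apply: continuous_comp; [exact: cvg_snd|exact: coord_continuous].
rewrite (_ : (fun _ => _) = fst); first exact: cvg_fst.
by apply/funext => y; exact: (@cons_rV0 R).
Qed.

(** [cons_rV] maps lines to lines; with the two lemmas on [basis_rV] below, a partial derivative in
    dimension [n.+1] becomes a derivative in one of the two factors. *)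
Lemma cons_rVD n (a b : R) (y z : 'rV[R]_n) (h : R) :
  cons_rV (a + h * b, y + h *: z) = cons_rV (a, y) + h *: cons_rV (b, z).
Proof.
apply/rowP => i; rewrite [RHS]mxE [X in _ = _ + X]mxE.
have [j ->|->] := unliftP ord0 i; first by rewrite !cons_rVS !mxE.
by rewrite !cons_rV0.
Qed.

Lemma basis_rV0 n : basis_rV (ord0 : 'I_n.+1) = cons_rV (1 : R, 0).
Proof.
apply/rowP => i; rewrite [LHS]mxE eqxx/=.
have [j ->|->] := unliftP ord0 i; first by rewrite cons_rVS mxE.
by rewrite cons_rV0 eqxx.
Qed.

Lemma basis_rVS n (j : 'I_n) :
  basis_rV (lift ord0 j) = cons_rV (0 : R, basis_rV j).
Proof.
apply/rowP => i; rewrite [LHS]mxE eqxx/=.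
have [k ->|->] := unliftP ord0 i.
  by rewrite cons_rVS !mxE eqxx/= (inj_eq lift_inj).
by rewrite cons_rV0.
Qed.

Lemma measurable_continuous_rV n (h : 'rV[R]_n -> R) :
  continuous h -> measurable_fun setT h.
Proof.
move=> /continuousP ch; apply: (measurability _ (RGenOpens.measurableE R)).
move=> _ [_ [a [b ->] <-]]; rewrite setTI.
by apply: open_measurable_rV; exact/ch/interval_open.
Qed.

Lemma measurable_compact_rV n (K : set 'rV[R]_n) : compact K -> measurable K.
Proof.
move=> cK; have /closed_openC oK : closed K.
  by apply: (compact_closed _ cK); exact: norm_hausdorff.
rewrite -(setCK K); apply: measurableC; exact: open_measurable_rV.
Qed.

Definition box n (a b : R) : set 'rV[R]_n :=
  [set x | forall i, x ord0 i \in `[a, b]].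

Lemma compact_box n (a b : R) : compact (@box n a b).
Proof. by apply: (rV_compact (A := fun=> `[a, b]%classic)) => _; exact: segment_compact. Qed.

Lemma measurable_box n (a b : R) : measurable (@box n a b).
Proof. apply: measurable_compact_rV; exact: compact_box. Qed.

Lemma lebesgue_box n (a b : R) : a <= b ->
  lebesgue_rV n (box a b) = ((b - a) ^+ n)%:E.
Proof.
move=> ab; rewrite (lebesgue_rV_prod (A := fun=> `[a, b]%classic))//.
transitivity (\prod_(i < n) (b - a)%:E)%E.
  apply: eq_bigr => i _; rewrite /= lebesgue_measure_itv/= lte_fin -EFinD.
  by case: ltP => // ba; rewrite (le_anti (introT andP (conj ab ba))) subrr.
rewrite big_const_ord; elim: n => //= n ->.
by rewrite -EFinM exprS.
Qed.

Lemma lebesgue_box_lty n (a b : R) : (lebesgue_rV n (box a b) < +oo)%E.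
Proof.
have [ab|ba] := leP a b; first by rewrite lebesgue_box// ltry.
(* In dimension 0 the box is the single point even for [b < a]; in positive dimension it is then
   empty. *)
case: n => [|n].
  by rewrite /= (le_lt_trans (probability_le1 (\d_(0 : 'rV[R]_0)) (@measurable_box 0 a b)))// ltry.
rewrite (_ : box _ _ = set0) ?measure0// -subset0 => x /(_ ord0).
by rewrite in_itv/= => /andP[/le_trans h/h]; rewrite leNgt ba.
Qed.

Lemma integrable_box n (a b : R) (h : 'rV[R]_n -> R) :
  continuous h -> (lebesgue_rV n).-integrable (box a b) (EFin \o h).
Proof.
move=> ch; apply: measurable_bounded_integrable.
- exact: measurable_box.
- exact: lebesgue_box_lty.
- apply: measurable_funTS; exact: measurable_continuous_rV.
have : compact (h @` box a b).
  apply: continuous_compact; last exact: compact_box.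
  exact: continuous_subspaceT.
move=> /compact_bounded; rewrite /bounded_near /= => -[M [Mr hM]].
exists M; split => // y /hM{}hM x /= bx; apply: hM.
by exists x.
Qed.

End row_vectors.

(** * Integration by parts on a box *)

Section integration_by_parts.
Context {R : realType}.

(** The two difference quotients are the same function of the increment, so the directional
    derivative alone is enough and no differentiability of [F] enters. *)
Lemma is_derive_line (V W : normedModType R) (F : V -> W) (x v : V) (a : R) (D : W) :
  is_derive (x + a *: v) v F D -> is_derive a 1 (fun s => F (x + s *: v)) D.
Proof.
move=> [dF <-].
have E : (fun h => h^-1 *: (((fun s => F (x + s *: v)) \o shift a) (h *: 1) -
    F (x + a *: v))) =
  (fun h => h^-1 *: ((F \o shift (x + a *: v)) (h *: v) - F (x + a *: v))).
  apply/funext => h /=; congr (_ *: (F _ - _)).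
  by rewrite -[X in (X + a) *: v]/(h * 1) mulr1 scalerDl addrCA.
by apply: DeriveDef; rewrite /derivable /derive E.
Qed.

(** Fubini for the pushforward of the product measure. The first order of integration drives the
    induction on later coordinates, the second isolates the first coordinate for the fundamental
    theorem of calculus. *)
Lemma integral_box_cons n (a b : R) (h : 'rV[R]_n.+1 -> R) : continuous h ->
  (\int[lebesgue_rV n.+1]_(x in box a b) (h x)%:E =
    \int[lebesgue_measure]_(s in `[a, b])
      \int[lebesgue_rV n]_(y in box a b) (h (cons_rV (s, y)))%:E)%E /\
  (\int[lebesgue_rV n.+1]_(x in box a b) (h x)%:E =
    \int[lebesgue_rV n]_(y in box a b)
      \int[lebesgue_measure]_(s in `[a, b]) (h (cons_rV (s, y)))%:E)%E.
Proof.
move=> ch; pose F : 'rV[R]_n.+1 -> \bar R := (EFin \o h) \_ (box a b).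
have iF : (lebesgue_rV n.+1).-integrable setT F.
  apply: (integrable_mkcond _ (@measurable_box R n.+1 a b)).1.
  exact: integrable_box.
have mF := measurable_int _ iF.
have mcons := @measurable_cons_rV R n.
have iFc : (lebesgue_measure \x lebesgue_rV n)%E.-integrable setT
    (F \o @cons_rV R n).
  apply/integrableP; split; first exact: (measurableT_comp mF mcons).
  have /integrableP[_] := iF.
  by rewrite ge0_integral_pushforward//; exact: measurableT_comp.
have E0 : (\int[lebesgue_rV n.+1]_(x in box a b) (h x)%:E =
   \int[lebesgue_measure \x lebesgue_rV n]_z (F \o @cons_rV R n) z)%E.
  rewrite integral_mkcond.
  exact: (integral_pushforward mcons mF iFc measurableT).
(* The indicator of the cube is the product of the indicators of the interval and of the
   lower-dimensional cube, so integrals over the whole factors reduce to integrals over these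
   sets. *)
have Fc s y : F (cons_rV (s, y)) =
    ((fun s => (fun y => (h (cons_rV (s, y)))%:E) \_ (box a b) y) \_ `[a, b] s)%E.
  rewrite /F !patchE; case: ifPn => [/set_mem Q|/negP Q].
    rewrite mem_set /=; last by have := Q ord0; rewrite cons_rV0.
    by rewrite mem_set//= => i; have := Q (lift ord0 i); rewrite cons_rVS.
  case: ifPn => // /set_mem/= sab; case: ifPn => // /set_mem yab.
  exfalso; apply: Q; apply/mem_set => i.
  by have [j ->|->] := unliftP ord0 i; rewrite ?cons_rVS ?cons_rV0.
split.
  rewrite E0 -integral12_prod_meas1// [RHS]integral_mkcond.
  apply: eq_integral => s _; rewrite /fubini_F.
  under eq_integral do rewrite /= Fc.
  rewrite patchE; case: ifPn => sab; last first.
    by under eq_integral do rewrite patchE (negbTE sab); rewrite integral0.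
  rewrite [RHS]integral_mkcond.
  by apply: eq_integral => y _; rewrite patchE sab.
rewrite E0 -integral21_prod_meas1// [RHS]integral_mkcond.
apply: eq_integral => y _; rewrite /fubini_G.
under eq_integral do rewrite /= Fc.
rewrite patchE; case: ifPn => yab; last first.
  under eq_integral do rewrite !patchE (negbTE yab) if_same.
  by rewrite integral0.
rewrite [RHS]integral_mkcond.
by apply: eq_integral => s _; rewrite !patchE yab.
Qed.

Lemma is_derive_cons_rV0 n (w : 'rV[R]_n.+1 -> R) (y : 'rV[R]_n) (s D : R) :
  is_derive (cons_rV (s, y)) (basis_rV ord0) w D ->
  is_derive s 1 (fun s => w (cons_rV (s, y))) D.
Proof.
have E r : cons_rV (r, y) = cons_rV (0, y) + r *: basis_rV ord0.
  by rewrite basis_rV0 -cons_rVD scaler0 addr0 mulr1 add0r.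
rewrite [in X in X -> _]E => /is_derive_line.
by under eq_fun do rewrite -E.
Qed.

Lemma is_derive_cons_rVS n (w : 'rV[R]_n.+1 -> R) (y : 'rV[R]_n) (s D : R) j :
  is_derive (cons_rV (s, y)) (basis_rV (lift ord0 j)) w D ->
  is_derive y (basis_rV j) (fun y => w (cons_rV (s, y))) D.
Proof.
move=> [dw <-].
have E : (fun h : R => h^-1 *: (((fun y => w (cons_rV (s, y))) \o shift y) (h *: basis_rV j) -
    w (cons_rV (s, y)))) =
  (fun h => h^-1 *: ((w \o shift (cons_rV (s, y))) (h *: basis_rV (lift ord0 j)) - w (cons_rV (s, y)))).
  apply/funext => h /=; congr (_ *: (w _ - _)).
  by rewrite basis_rVS addrC [RHS]addrC -cons_rVD mulr0 addr0.
by apply: DeriveDef; rewrite /derivable /derive E.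
Qed.

Lemma continuous_cons_rVl n (y : 'rV[R]_n) :
  continuous (fun s : R => cons_rV (s, y)).
Proof.
move=> s; apply: (@continuous_at_pairl R _ _ (@cons_rV R n)).
exact: continuous_cons_rV.
Qed.

Lemma continuous_cons_rVr n (s : R) :
  continuous (fun y : 'rV[R]_n => cons_rV (s, y)).
Proof.
move=> y; apply: (@continuous_at_pairr R _ _ (@cons_rV R n)).
exact: continuous_cons_rV.
Qed.

(** By induction on the dimension: a later coordinate is handled in each slice with the first one
    frozen; for the first coordinate, the inner integral is a difference of two values of [w] on
    opposite faces, both zero. *)
Lemma integral_box_partial n (i : 'I_n) (a b : R) (w w' : 'rV[R]_n -> R) :
  a < b -> continuous w' ->
  (forall x : 'rV[R]_n, is_derive x (basis_rV i) w (w' x)) ->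
  (forall x : 'rV[R]_n, x ord0 i = a \/ x ord0 i = b -> w x = 0) ->
  (\int[lebesgue_rV n]_(x in box a b) (w' x)%:E = 0)%E.
Proof.
move=> ab; elim: n i w w' => [[]//|n IH] i w w' cw' dw w0.
have [j ij|i0] := unliftP ord0 i.
  rewrite (integral_box_cons _ _ cw').1 integral0_eq// => s _.
  apply: (IH j (fun y => w (cons_rV (s, y)))) => [y|y|y yab].
  - by apply: continuous_comp; [exact: continuous_cons_rVr|exact: cw'].
  - by apply: is_derive_cons_rVS; rewrite -ij.
  - by apply: w0; rewrite ij cons_rVS.
rewrite (integral_box_cons _ _ cw').2 integral0_eq// => y _.
have dw1 (s : R) : is_derive s 1 (fun s => w (cons_rV (s, y))) (w' (cons_rV (s, y))).
  by apply: is_derive_cons_rV0; rewrite -i0.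
rewrite (@continuous_FTC2 _ _ (fun s => w (cons_rV (s, y))))//.
- by rewrite !w0 ?subee// i0 cons_rV0; [left|right].
- apply: continuous_subspaceT => s.
  by apply: continuous_comp; [exact: continuous_cons_rVl|exact: cw'].
- have cw s : {for s, continuous (fun s => w (cons_rV (s, y)))}.
    by apply: differentiable_continuous; apply/derivable1_diffP; case: (dw1 s).
  split => [s _|/=|/=]; first by case: (dw1 s).
  + by apply: cvg_at_right_filter; exact: cw.
  + by apply: cvg_at_left_filter; exact: cw.
- by move=> s _; rewrite derive1E derive_val.
Qed.
End integration_by_parts.

(** * Bump functions and supersolutions *)

Section bump_functions.
Context {R : realType}.
Implicit Types k s : R.

Lemma continuous_sum_fun (T : topologicalType) (I : Type) (r : seq I) (P : pred I)
    (F : I -> T -> R) :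
  (forall i, P i -> continuous (F i)) ->
  continuous (fun x => \sum_(i <- r | P i) F i x).
Proof.
move=> cF; rewrite -fct_sumE.
elim/big_ind: _ => [|f g cf cg x|//]; first exact: cst_continuous.
exact: continuousD (cf x) (cg x).
Qed.

Lemma continuous_prod_fun (T : topologicalType) (I : Type) (r : seq I) (P : pred I)
    (F : I -> T -> R) :
  (forall i, P i -> continuous (F i)) ->
  continuous (fun x => \prod_(i <- r | P i) F i x).
Proof.
move=> cF; rewrite -fct_prodE.
elim/big_ind: _ => [|f g cf cg x|//]; first exact: cst_continuous.
exact: continuousM (cf x) (cg x).
Qed.

Definition bumpR k s : R := (k * s * (1 - k * s)) ^+ 2.
Definition bumpR' k s : R := 2 * k * (k * s * (1 - k * s)) * (1 - 2 * (k * s)).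
Definition bumpR'' k s : R := k ^+ 2 * (2 - 12 * (k * s * (1 - k * s))).

Lemma is_derive_bump k s : is_derive s 1 (bumpR k) (bumpR' k s).
Proof.
rewrite (_ : bumpR k = ((k \*: id) * (cst 1 - k \*: id)) ^+ 2); last first.
  by apply/funext.
apply: is_derive_eq.
rewrite /bumpR' !fctE /GRing.scale/= -![_ *: _]/(_ * _); ring.
Qed.

Lemma is_derive_bump' k s : is_derive s 1 (bumpR' k) (bumpR'' k s).
Proof.
rewrite (_ : bumpR' k = ((2 * k) \*: ((k \*: id) * (cst 1 - k \*: id))) *
    (cst 1 - (2 * k) \*: id)); last first.
  apply/funext => r; rewrite /bumpR' !fctE.
  rewrite /GRing.scale/= -![_ *: _]/(_ * _); ring.
apply: is_derive_eq.
rewrite /bumpR'' !fctE /GRing.scale/= -![_ *: _]/(_ * _); ring.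
Qed.

Lemma continuous_is_derive (f f' : R -> R) :
  (forall s : R, is_derive s 1 f (f' s)) -> continuous f.
Proof.
move=> df s; apply: differentiable_continuous; apply/derivable1_diffP.
by case: (df s).
Qed.

Lemma continuous_bump'' k : continuous (bumpR'' k).
Proof.
apply: (continuous_is_derive (f' := fun s => - 12 * k ^+ 3 * (1 - 2 * (k * s)))) => s.
rewrite (_ : bumpR'' k = (k ^+ 2) \*: (cst 2 - 12 \*: ((k \*: id) * (cst 1 - k \*: id)))); last first.
  by apply/funext.
apply: is_derive_eq.
rewrite !fctE /GRing.scale/= -![_ *: _]/(_ * _); ring.
Qed.

Lemma bump_ge0 k s : 0 <= bumpR k s. Proof. exact: sqr_ge0. Qed.

Lemma bump_le1 k s : 0 < k -> s \in `[0, k^-1] -> bumpR k s <= 1.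
Proof.
move=> k0; rewrite in_itv/= => /andP[s0 sk].
have q0 : 0 <= k * s by rewrite mulr_ge0// ltW.
have q1 : k * s <= 1 by rewrite -(mulfV (lt0r_neq0 k0)) ler_pM2l.
by rewrite /bumpR expr_le1//; nra.
Qed.

(* [bumpR'' + 18 k^2 bumpR = 2 k^2 (1 - 3 q)^2] with [q = k s (1 - k s)]. *)
Lemma bumpR''_ge k s : - (18 * k ^+ 2) * bumpR k s <= bumpR'' k s.
Proof.
rewrite -subr_ge0 (_ : _ - _ = 2 * k ^+ 2 * (1 - 3 * (k * s * (1 - k * s))) ^+ 2).
  by rewrite mulr_ge0 ?sqr_ge0// mulr_ge0 ?sqr_ge0.
rewrite /bumpR /bumpR''; ring.
Qed.

Lemma is_derive_coord n (G : R -> R) (i : 'I_n) (x : 'rV[R]_n) (D : R) :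
  is_derive (x ord0 i) 1 G D ->
  is_derive x (basis_rV i) (fun y => G (y ord0 i)) D.
Proof.
move=> [dG <-].
have E : (fun h : R => h^-1 *: (((fun y : 'rV[R]_n => G (y ord0 i)) \o shift x) (h *: basis_rV i) -
    G (x ord0 i))) =
  (fun h : R => h^-1 *: ((G \o shift (x ord0 i)) (h *: 1) - G (x ord0 i))).
  by apply/funext => h /=; rewrite !mxE !eqxx/=.
by apply: DeriveDef; rewrite /derivable /derive E.
Qed.

Lemma is_derive_indep n (v x : 'rV[R]_n) (F : 'rV[R]_n -> R) :
  (forall h, F (h *: v + x) = F x) -> is_derive x v F 0.
Proof.
move=> Fv.
have E : (fun h : R => h^-1 *: ((F \o shift x) (h *: v) - F x)) = cst 0.
  by apply/funext => h /=; rewrite Fv subrr scaler0.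
apply: DeriveDef; rewrite /derivable /derive E; first exact: is_cvg_cst.
exact: lim_cst.
Qed.

Variable n : nat.

Definition bump_rV k (x : 'rV[R]_n) : R := \prod_i bumpR k (x ord0 i).

(** Not a derivative: the cofactor of the [i]-th factor of [bump_rV], constant in direction [i]. *)
Definition bump_rV' k (i : 'I_n) (x : 'rV[R]_n) : R :=
  \prod_(j | j != i) bumpR k (x ord0 j).

Lemma bump_rVE k i x : bump_rV k x = bumpR k (x ord0 i) * bump_rV' k i x.
Proof. by rewrite /bump_rV (bigD1 i). Qed.

Lemma continuous_bump_coord k (i : 'I_n) :
  continuous (fun x : 'rV[R]_n => bumpR k (x ord0 i)).
Proof.
move=> x; apply: (@continuous_comp _ _ _ (fun M : 'rV[R]_n => M ord0 i) (bumpR k)).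
  exact: coord_continuous.
exact: (continuous_is_derive (is_derive_bump k)).
Qed.

Lemma continuous_bump_rV k : continuous (bump_rV k).
Proof. by apply: continuous_prod_fun => i _; exact: continuous_bump_coord. Qed.

Lemma continuous_bump_rV' k i : continuous (bump_rV' k i).
Proof. by apply: continuous_prod_fun => j _; exact: continuous_bump_coord. Qed.

Lemma is_derive_bump_rV' k i x : is_derive x (basis_rV i) (bump_rV' k i) 0.
Proof.
apply: is_derive_indep => h; apply: eq_bigr => j ji.
by rewrite !mxE eqxx (negbTE ji) mulr0 add0r.
Qed.

Lemma bump_rV_ge0 k x : 0 <= bump_rV k x.
Proof. by apply: prodr_ge0 => i _; exact: bump_ge0. Qed.

Lemma bump_rV'_ge0 k i x : 0 <= bump_rV' k i x.
Proof. by apply: prodr_ge0 => j _; exact: bump_ge0. Qed.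

Lemma bump_rV_le1 k x : 0 < k -> box 0 k^-1 x -> bump_rV k x <= 1.
Proof.
by move=> k0 xk; apply: prodr_ile1 => i _; rewrite bump_ge0 bump_le1//; exact: xk.
Qed.

(* The boundary terms vanish since [0] and [1/k] are double roots of
   [bumpR k]. *)
Lemma integral_box_bump k (i : 'I_n) (v : 'rV[R]_n -> R) : 0 < k ->
  (forall x, derivable v x (basis_rV i)) ->
  (forall x, derivable ('D_(basis_rV i) v) x (basis_rV i)) ->
  continuous v -> continuous ('D_(basis_rV i) ('D_(basis_rV i) v)) ->
  let h x := bump_rV' k i x *
    ('D_(basis_rV i) ('D_(basis_rV i) v) x * bumpR k (x ord0 i) -
     v x * bumpR'' k (x ord0 i)) in
  continuous h /\ (\int[lebesgue_rV n]_(x in box 0 k^-1) (h x)%:E = 0)%E.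
Proof.
move=> k0 dv ddv cv cddv h.
have ch : continuous h.
  move=> x; apply: continuousM; first exact: continuous_bump_rV'.
  apply: continuousB.
    by apply: continuousM; [exact: cddv|exact: continuous_bump_coord].
  apply: continuousM; first exact: cv.
  apply: (@continuous_comp _ _ _ (fun M : 'rV[R]_n => M ord0 i) (bumpR'' k)).
    exact: coord_continuous.
  exact: continuous_bump''.
split => //.
(* With [g = bumpR k], this is the cofactor times [v' g - v g']; the mixed terms [v' g'] cancel on
   differentiating in direction [i], which leaves [h]. *)
pose w := bump_rV' k i * ('D_(basis_rV i) v * (fun x : 'rV[R]_n => bumpR k (x ord0 i)) -
     v * (fun x : 'rV[R]_n => bumpR' k (x ord0 i))).
apply: (@integral_box_partial _ _ i _ _ w) => // [|x|x].
- by rewrite invr_gt0.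
- have d0 := is_derive_bump_rV' k i x.
  have d1 : is_derive x (basis_rV i) v ('D_(basis_rV i) v x) by exact: derivableP.
  have d2 : is_derive x (basis_rV i) ('D_(basis_rV i) v)
    ('D_(basis_rV i) ('D_(basis_rV i) v) x) by exact: derivableP.
  have d3 := is_derive_coord (is_derive_bump k (x ord0 i)).
  have d4 := is_derive_coord (is_derive_bump' k (x ord0 i)).
  apply: is_derive_eq; rewrite /h !fctE /GRing.scale/=; ring.
- rewrite /w !fctE /bumpR /bumpR' => -[->|->]; last rewrite mulfV ?gt_eqF//; ring.
Qed.

(** Integration by parts moves the Laplacian onto the bump at a cost of at most [18 k^2 v] per
    coordinate, and the potential costs at most [n v]. Together they cost [K v], and
    [2 K (v - eta) - K v = K (v - 2 eta)]. *)
Lemma supersolution_moment_ge k eta (v vt : 'rV[R]_n -> R) :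
  1 <= k ->
  (forall x, box 0 k^-1 x -> 0 <= v x) ->
  continuous v -> continuous vt ->
  (forall x i, derivable v x (basis_rV i)) ->
  (forall x i, derivable ('D_(basis_rV i) v) x (basis_rV i)) ->
  (forall i, continuous ('D_(basis_rV i) ('D_(basis_rV i) v))) ->
  let K := n%:R * (18 * k ^+ 2 + 1) in
  (forall x, box 0 k^-1 x -> 2 * K * (v x - eta) <=
     vt x + (- laplacian v x + sqnorm x * v x)) ->
  K * (\int[lebesgue_rV n]_(x in box 0 k^-1) (v x * bump_rV k x) -
    2 * eta * \int[lebesgue_rV n]_(x in box 0 k^-1) bump_rV k x) <=
  \int[lebesgue_rV n]_(x in box 0 k^-1) (vt x * bump_rV k x).
Proof.
move=> k1 v0 cv cvt dv ddv cddv K vtE.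
have k0 : 0 < k by exact: lt_le_trans k1.
pose h i x := bump_rV' k i x *
    ('D_(basis_rV i) ('D_(basis_rV i) v) x * bumpR k (x ord0 i) -
     v x * bumpR'' k (x ord0 i)).
have hP i := integral_box_bump k0 (dv ^~ i) (ddv ^~ i) cv (cddv i).
have cb := @continuous_bump_rV k.
have cM (f g : 'rV[R]_n -> R) : continuous f -> continuous g -> continuous (fun x => f x * g x).
  by move=> cf cg x; exact: continuousM (cf x) (cg x).
have cB (f g : 'rV[R]_n -> R) : continuous f -> continuous g -> continuous (fun x => f x - g x).
  by move=> cf cg x; exact: continuousB (cf x) (cg x).
have cC (c : R) : continuous (fun _ : 'rV[R]_n => c) by exact: cst_continuous.
have cS : continuous (fun x => \sum_i h i x).
  by apply: continuous_sum_fun => i _; case: (hP i).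
have S0 : \int[lebesgue_rV n]_(x in box 0 k^-1) (\sum_i h i x) = 0.
  rewrite /Rintegral; under eq_integral do rewrite -sumEFin.
  rewrite integral_sum//; last first.
  - by move=> i; apply: integrable_box; case: (hP i).
  - exact: measurable_box.
  by rewrite big1// => i _; case: (hP i).
have I f : continuous f -> (lebesgue_rV n).-integrable (box 0 k^-1) (EFin \o f).
  exact: integrable_box.
have mB := @measurable_box R n 0 k^-1.
(* Subtracting a sum of zero integral reduces the claim to a pointwise inequality of integrands. *)
have <- : \int[lebesgue_rV n]_(x in box 0 k^-1) (vt x * bump_rV k x - \sum_i h i x) =
    \int[lebesgue_rV n]_(x in box 0 k^-1) (vt x * bump_rV k x).
  by rewrite RintegralB ?S0 ?subr0//; apply: I => //; exact: cM.
have cve : continuous (fun x => v x - 2 * eta).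
  exact: cB.
have -> : K * (\int[lebesgue_rV n]_(x in box 0 k^-1) (v x * bump_rV k x) -
    2 * eta * \int[lebesgue_rV n]_(x in box 0 k^-1) bump_rV k x) =
    \int[lebesgue_rV n]_(x in box 0 k^-1) (K * ((v x - 2 * eta) * bump_rV k x)).
  rewrite RintegralZl//; last by apply: I; exact: cM.
  congr (_ * _).
  rewrite -RintegralZl//; last exact: I.
  rewrite -RintegralB//.
  - by apply: eq_Rintegral => x _; rewrite mulrBl.
  - by apply: I; exact: cM.
  - by apply: I; exact: cM.
apply: le_Rintegral => //.
- by apply: I; apply: (cM) => //; exact: cM.
- by apply: I; apply: cB => //; exact: cM.
move=> x xB.
have [v0x b0] := (v0 x xB, bump_rV_ge0 k x).
(* As [1 <= k], the cube lies in the unit cube. *)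
have sq : sqnorm x <= n%:R.
  apply: (@le_trans _ _ (\sum_(i < n) 1)); last by rewrite sumr_const card_ord.
  apply: ler_sum => i _; have := xB i; rewrite in_itv/= => /andP[xi0 xik].
  by rewrite expr_le1// (le_trans xik)// invf_le1.
have hle : \sum_i h i x <= bump_rV k x * (laplacian v x + n%:R * (18 * k ^+ 2) * v x).
  rewrite mulrDr /laplacian mulr_sumr.
  rewrite (_ : _ * (n%:R * _ * _) = \sum_(i < n) bump_rV k x * (18 * k ^+ 2 * v x)); last first.
    by rewrite sumr_const card_ord -mulr_natl; ring.
  rewrite -big_split/=; apply: ler_sum => i _; rewrite /h (bump_rVE k i).
  have := bumpR''_ge k (x ord0 i); have := bump_rV'_ge0 k i x.
  set A := bump_rV' _ _ _; set B := bumpR _ _; set C := bumpR'' _ _ => A0 BC.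
  rewrite -subr_ge0 (_ : _ - _ = A * ((C + 18 * k ^+ 2 * B) * v x)); last by ring.
  by rewrite mulr_ge0// mulr_ge0//; lra.
have := ler_wpM2r b0 (vtE x xB).
have : sqnorm x * v x * bump_rV k x <= n%:R * v x * bump_rV k x.
  by rewrite ler_wpM2r// ler_wpM2r.
rewrite /K; set L := laplacian v x in hle *; set b := bump_rV k x in hle *.
move: (\sum_i h i x) hle => S hle; nra.
Qed.

End bump_functions.

(** * The singular datum *)

Section datum.
Context {R : realType}.

(* Unlike [ge0_le_integral], no measurability is required: the integral of a
   nonnegative function is a supremum over simple functions. *)
Lemma le_nnintegral d (T : measurableType d) (mu : {measure set T -> \bar R})
    (f g : T -> \bar R) : (forall x, 0 <= f x)%E -> (forall x, f x <= g x)%E ->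
  (\int[mu]_x f x <= \int[mu]_x g x)%E.
Proof.
move=> f0 fg; have g0 x : (0 <= g x)%E by exact: le_trans (fg x).
rewrite !ge0_integralTE//; apply: le_ereal_sup => _ [h hf <-].
by exists h => // x; exact: le_trans (hf x) (fg x).
Qed.

Lemma normr_rV_le n (x : 'rV[R]_n) r : 0 <= r ->
  (`|x| <= r) <-> (forall i, `|x ord0 i| <= r).
Proof.
move=> r0; rewrite [`|x|]mx_normrE; split=> [/bigmax_leP[_ h] i|h].
  exact: (h (ord0, i)).
by apply/bigmax_leP; split=> // -[i j] _ /=; rewrite (ord1 i).
Qed.

Lemma nneseries_geometric_lty (c q : R) : 0 <= q < 1 ->
  (\sum_(n <oo) (c * q ^+ n)%:E < +oo)%E.
Proof.
move=> /andP[q0 q1]; rewrite (_ : limn _ = (limn (series (geometric c q)))%:E).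
  exact: ltry.
rewrite -EFin_lim; last by apply: is_cvg_geometric_series; rewrite ger0_norm.
by congr (limn _); apply/funext => n; rewrite /series/= -sumEFin.
Qed.

Variable n : nat.
Hypothesis n0 : (0 < n)%N.
Implicit Types x : 'rV[R]_n.

(* The positive part of [log (1/|x|)], except that [ln 0 = 0] makes it vanish
   at the origin. *)
Definition logdist x : R := - ln (Num.min 1 `|x|).

Lemma logdist_ge0 x : 0 <= logdist x.
Proof. by rewrite oppr_ge0 ln_le0// ge_min lexx. Qed.

Lemma measurable_logdist : measurable_fun setT logdist.
Proof.
apply: measurableT_comp => //; apply: measurableT_comp; first exact: measurable_ln.
apply: measurable_minr; first exact: measurable_cst.
by apply: measurable_continuous_rV; exact: norm_continuous.
Qed.

Lemma logdist_shell x : 0 < logdist x -> `|x| = expR (- logdist x).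
Proof.
move=> L0; have x1 : `|x| < 1.
  rewrite ltNge; apply/negP => x1; move: L0.
  by rewrite /logdist min_l// ln1 oppr0 ltxx.
have x0 : 0 < `|x|.
  rewrite normr_gt0; apply/eqP => x0; move: L0.
  by rewrite /logdist x0 normr0 min_r// ln0// oppr0 ltxx.
by rewrite /logdist min_r ?ltW// opprK lnK.
Qed.

(** If [m <= logdist x < m + 1], then [x] lies in the cube of half-side [exp (- m)] and the left
    side is below [exp ((m + 1) / 2)]: the [m]-th term alone dominates it. *)
Lemma expR_logdist_le x :
  ((expR (logdist x / 2) - 1)%:E <= \sum_(m <oo)
    (expR (m.+1%:R / 2) * \1_(box (- expR (- m%:R)) (expR (- m%:R))) x)%:E)%E.
Proof.
have F0 (m : nat) : (0 <= (expR (m.+1%:R / 2 : R) * \1_(box (- expR (- m%:R)) (expR (- m%:R))) x)%:E)%E.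
  by rewrite lee_fin mulr_ge0 ?expR_ge0.
have := logdist_ge0 x; rewrite le_eqVlt => /predU1P[<-|L0].
  by rewrite mul0r expR0 subrr nneseries_ge0.
have /andP[mL Lm] := truncn_itv (ltW L0); set m := Num.truncn _ in mL Lm.
have xB : box (- expR (- m%:R)) (expR (- m%:R)) x.
  move=> i; rewrite in_itv/= -ler_norml.
  have /normr_rV_le : 0 <= expR (- m%:R) :> R by exact: expR_ge0.
  by move=> /(_ _ x)[+ _]; apply; rewrite logdist_shell// ler_expR lerN2.
rewrite (@nneseriesD1 _ _ m)//.
apply: (@le_trans _ _ (expR (m.+1%:R / 2))%:E).
  rewrite lee_fin lerBlDr (@le_trans _ _ (expR (m.+1%:R / 2)))// ?lerDl//.
  by rewrite ler_expR ler_pM2r// ltW.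
by rewrite indicE mem_set// mulr1 leeDl// nneseries_ge0.
Qed.

(** Since [n >= 1], the [m]-th cube has volume at most [2^n exp (- m)]; against the weight
    [exp ((m + 1) / 2)] this leaves a geometric series of ratio [exp (- 1/2)]. *)
Lemma integral_logdist_lty :
  (\int[lebesgue_rV n]_x (expR (logdist x / 2) - 1)%:E < +oo)%E.
Proof.
have L0 x : (0 <= (expR (logdist x / 2) - 1)%:E)%E.
  by rewrite lee_fin subr_ge0 -expR0 ler_expR divr_ge0// logdist_ge0.
apply: (le_lt_trans (le_nnintegral _ L0 expR_logdist_le)).
have mB m := @measurable_box R n (- expR (- m%:R)) (expR (- m%:R)).
rewrite integral_nneseries//; last first.
  move=> m; apply/measurable_EFinP; apply: measurable_funM => //.
apply: (@le_lt_trans _ _ (\sum_(m <oo) (2 ^+ n * expR (1 / 2) * expR (- (1 / 2)) ^+ m)%:E)%E).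
  apply: lee_nneseries => [m _ _|m _].
    by apply: integral_ge0 => x _; rewrite lee_fin mulr_ge0 ?expR_ge0.
  rewrite (@integralZl_indic _ _ _ _ _ measurableT (fun=> box (- expR (- m%:R)) (expR (- m%:R))))//; last first.
    by rewrite ltNge expR_ge0.
  rewrite integral_indic//= setIT lebesgue_box; last first.
    by rewrite -subr_ge0 opprK addr_ge0 ?expR_ge0.
  rewrite (_ : expR _ - _ = 2 * expR (- m%:R)); last by ring.
  rewrite exprMn -EFinM lee_fin.
  rewrite mulrCA -mulrA ler_pM2l ?exprn_gt0//.
  have e1 : expR (- m%:R) <= 1 :> R by rewrite -[leRHS]expR0 ler_expR oppr_le0.
  apply: (@le_trans _ _ (expR (m.+1%:R / 2) * expR (- m%:R))).
    by rewrite ler_pM2l ?expR_gt0//; apply: (ler_wiXn2l (expR_ge0 _) e1 n0).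
  rewrite -expRM_natl -!expRD ler_expR -natr1.
  lra.
apply: nneseries_geometric_lty.
by rewrite expR_ge0/= -[ltRHS]expR0 ltr_expR; lra.
Qed.

End datum.

(** * Exponential integrability of the datum and admissible test functions *)

Section exp_orlicz.
Context {R : realType}.
Variable n : nat.
Hypothesis n0 : (0 < n)%N.
Variables (lambda p : R).
Hypotheses (lambda_gt0 : 0 < lambda) (p_gt1 : 1 < p).
Implicit Types x : 'rV[R]_n.

(** The factor 3 leaves a strict gap above the threshold [2 eta]; [4 / lambda] makes half of the
    exponent [lambda eta^p] equal to [2 log k]. *)
Definition datum x : R := 3 * (4 / lambda * logdist x) `^ p^-1.

Let p0 : 0 < p. Proof. exact: lt_trans p_gt1. Qed.

Lemma datum_ge0 x : 0 <= datum x.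
Proof. by rewrite mulr_ge0// powR_ge0. Qed.

Lemma measurable_datum : measurable_fun setT datum.
Proof.
apply: measurable_funM => //.
apply: (measurableT_comp (f := @powR R ^~ p^-1)); first exact: measurable_powR.
by apply: measurable_funM => //; exact: measurable_logdist.
Qed.

(* For this [mu] the modular of [datum] integrates [|x|^(-1/2) - 1] over the
   unit cube. *)
Definition datum_scale : R := 3 * (8 / lambda) `^ p^-1.

Lemma datum_scale_gt0 : 0 < datum_scale.
Proof. by rewrite mulr_gt0// powR_gt0// divr_gt0. Qed.

Lemma datum_scaleE x : `|datum x| `^ p / datum_scale `^ p = logdist x / 2.
Proof.
have l0 : 0 <= 4 / lambda * logdist x.
  by rewrite mulr_ge0 ?logdist_ge0// divr_ge0// ltW.
have E a : 0 <= a -> (3 * a `^ p^-1) `^ p = 3 `^ p * a.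
  move=> a0; rewrite powRM ?powR_ge0//.
  by rewrite -powRrM mulVf ?gt_eqF// powRr1.
rewrite ger0_norm ?datum_ge0// /datum /datum_scale !E//; last first.
  by rewrite divr_ge0// ltW.
have : 3 `^ p != 0 :> R by rewrite gt_eqF// powR_gt0.
by move=> ?; field; rewrite gt_eqF.
Qed.

Lemma exp_modular_datum_lty : (exp_modular p datum_scale datum < +oo)%E.
Proof.
rewrite /exp_modular; under eq_integral do rewrite datum_scaleE.
exact: integral_logdist_lty.
Qed.

(** Let [s = datum x / datum_scale]. The indicator pays for [s <= 1]; if [s > 1], then
    [s <= s^p = logdist x / 2], which the exponential dominates. Where [logdist] vanishes, so does
    the datum. *)
Lemma datum_le x : datum x <=
  datum_scale * (\1_(box (-1) 1) x + (expR (logdist x / 2) - 1)).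
Proof.
have L0 := logdist_ge0 x; have m0 := datum_scale_gt0.
have e0 : 1 + logdist x / 2 <= expR (logdist x / 2) by exact: expR_ge1Dx.
have [x0|xN0] := eqVneq (logdist x) 0.
  rewrite /datum x0 mulr0 powR0 ?invr_eq0 ?gt_eqF// mulr0 mul0r expR0 subrr addr0.
  by rewrite mulr_ge0// ltW.
have {xN0}L1 : 0 < logdist x by rewrite lt_neqAle eq_sym xN0.
have -> : \1_(box (-1) 1) x = 1 :> R.
  rewrite indicE mem_set// => i; rewrite in_itv/= -ler_norml.
  have [+ _] := @normr_rV_le R n x 1 ler01.
  by apply; rewrite logdist_shell// -[leRHS]expR0 ler_expR oppr_le0.
rewrite -ler_pdivrMl//; set s := _^-1 * _.
have s0 : 0 <= s by rewrite mulr_ge0 ?datum_ge0// invr_ge0 ltW.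
have sp : s `^ p = logdist x / 2.
  have mp : datum_scale `^ p != 0 by rewrite gt_eqF// powR_gt0.
  apply: (mulIf mp); rewrite -datum_scaleE divfK// -powRM ?(ltW m0)//.
  by rewrite ger0_norm ?datum_ge0// /s mulrAC mulVf ?mul1r// gt_eqF.
have [s1|s1] := leP s 1; first by lra.
have : s `^ 1 <= s `^ p by apply: ler_powR; exact: ltW.
rewrite powRr1// sp; lra.
Qed.

Lemma expL_datum : expL p datum.
Proof.
split; last by exists datum_scale; [exact: datum_scale_gt0|exact: exp_modular_datum_lty].
split; first exact: measurable_datum.
move=> K cK; have mu0 := datum_scale_gt0.
apply: (@le_lt_trans _ _ (\int[lebesgue_rV n]_x `|datum x|%:E)%E).
  apply: ge0_subset_integral => //; first exact: measurable_compact_rV.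
  by apply/measurable_EFinP; apply: measurableT_comp => //; exact: measurable_datum.
have e0 x : 0 <= expR (logdist x / 2) - 1.
  by rewrite subr_ge0 -[leLHS]expR0 ler_expR divr_ge0// logdist_ge0.
apply: (@le_lt_trans _ _ (\int[lebesgue_rV n]_x (datum_scale%:E *
    ((\1_(box (-1) 1) x)%:E + (expR (logdist x / 2) - 1)%:E)))%E).
  apply: le_nnintegral => x; first by rewrite lee_fin.
  by rewrite -EFinD -EFinM lee_fin ger0_norm ?datum_ge0// datum_le.
have mB := @measurable_box R n (-1) 1.
have mi : measurable_fun setT (fun x => (\1_(box (-1) 1) x)%:E : \bar R).
  by apply/measurable_EFinP; exact: measurable_indic.
have me : measurable_fun setT (fun x => (expR (logdist x / 2) - 1)%:E).
  apply/measurable_EFinP; apply: measurable_funB => //; apply: measurableT_comp => //.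
  by apply: measurable_funM => //; exact: measurable_logdist.
rewrite ge0_integralZl//; last 3 first.
- exact: emeasurable_funD.
- by move=> x _; rewrite adde_ge0// lee_fin.
- by rewrite lee_fin ltW.
rewrite ge0_integralD//; last by move=> x _; rewrite lee_fin.
rewrite lte_mul_pinfty ?lee_fin ?(ltW mu0)// lte_add_pinfty//.
  by rewrite integral_indic// setIT lebesgue_box_lty.
exact: integral_logdist_lty.
Qed.

(** On this open cube [0 < |x| <= 1/k], so the conventional value of [logdist] at the origin does
    not interfere and [logdist x >= log k]. *)
Lemma datum_ge k x : 1 <= k -> (forall i, 0 < x ord0 i < k^-1) ->
  3 * (4 / lambda * ln k) `^ p^-1 <= datum x.
Proof.
move=> k1 xk; have k0 : 0 < k by exact: lt_le_trans k1.
have xk' : `|x| <= k^-1.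
  apply/normr_rV_le; first by rewrite invr_ge0 ltW.
  by move=> i; have /andP[x0 x1] := xk i; rewrite gtr0_norm// ltW.
have x0 : 0 < `|x|.
  rewrite normr_gt0; apply/eqP => x0; have := xk (Ordinal n0).
  by rewrite x0 mxE ltxx.
rewrite /datum ler_pM2l//; apply: ge0_ler_powR.
- by rewrite invr_ge0 ltW.
- by rewrite nnegrE mulr_ge0 ?ln_ge0// divr_ge0// ltW.
- by rewrite nnegrE mulr_ge0 ?logdist_ge0// divr_ge0// ltW.
rewrite ler_pM2l ?divr_gt0// /logdist min_r; last first.
  by rewrite (le_trans xk')// invf_le1.
by rewrite lerNr -lnV ?posrE// ler_ln// posrE invr_gt0.
Qed.

Lemma psi_conj_ge0 r : (0 <= psi_conj p r)%E.
Proof.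
apply: ereal_sup_ubound; exists 0 => //=.
by rewrite mulr0 /psi powR0 ?gt_eqF// expR0 subrr subr0.
Qed.

Lemma psi_conj_le1 r : 0 <= r <= 1 -> (psi_conj p r <= 1)%E.
Proof.
move=> /andP[r0 r1]; apply: ge_ereal_sup => _ [s /= s0 <-]; rewrite lee_fin /psi.
have := expR_ge1Dx (s `^ p); have := powR_ge0 s p.
have rs : r * s <= s by rewrite ler_piMl.
(* For [s <= 1] the product [r s] is at most 1; for [s > 1], [r s <= s <= s^p <= psi p s]. *)
have [s1|s1] := leP s 1; first by lra.
have : s `^ 1 <= s `^ p by apply: ler_powR; exact: ltW.
rewrite powRr1//; lra.
Qed.

Lemma psi_conj0 : psi_conj p 0 = 0%E.
Proof.
apply/eqP; rewrite eq_le psi_conj_ge0 andbT.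
apply: ge_ereal_sup => _ [s /= s0 <-]; rewrite lee_fin /psi mul0r.
have := expR_ge1Dx (s `^ p); have := powR_ge0 s p; lra.
Qed.

(** With scale 1, the conjugate modular is at most the measure of [A]: [psi_conj] is at most 1 on
    [[0, 1]] and vanishes at 0. This admits the truncated bumps as test functions. *)
Lemma Lpsi_conj_indic (A : set 'rV[R]_n) (phi : 'rV[R]_n -> R) : measurable A ->
  (lebesgue_rV n A < +oo)%E -> measurable_fun setT phi ->
  (forall x, A x -> 0 <= phi x <= 1) -> Lpsi_conj p (phi \_ A).
Proof.
move=> mA Aoo mphi phi01; split.
  by apply/(measurable_restrictT _ mA); exact: measurable_funTS.
exists 1 => //; apply: (@le_lt_trans _ _ (\int[lebesgue_rV n]_x (\1_A x)%:E)%E).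
  apply: le_nnintegral => x; first exact: psi_conj_ge0.
  rewrite divr1 patchE indicE; case: ifPn => [/set_mem Ax|_].
    by have /andP[h0 h1] := phi01 x Ax; rewrite ger0_norm// psi_conj_le1// h0.
  by rewrite normr0 psi_conj0.
by rewrite integral_indic// setIT.
Qed.

End exp_orlicz.

(** * Evolution of the moments *)

Section evolution.
Context {R : realType}.

Lemma compact_norm_bounded (T : topologicalType) (f : T -> R) (A : set T) :
  compact A -> {in A, continuous f} ->
  exists2 M, 0 <= M & forall x, A x -> `|f x| <= M.
Proof.
move=> cA /continuous_in_subspaceT cf.
have /compact_bounded[M [Mr hM]] := continuous_compact cf cA.
exists `|M + 1| => // x Ax; apply: (le_trans _ (ler_norm _)).
by apply: (hM (M + 1)); [rewrite ltrDl|exists x].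
Qed.

(* The condition says that [expR (- K t) (m t - c)] is nondecreasing. *)
Lemma growth_ge (m dm : R -> R) (T K c : R) :
  (forall t : R, t \in `]0, T[ -> is_derive t 1 m (dm t)) ->
  (forall t, t \in `]0, T[ -> K * (m t - c) <= dm t) ->
  forall s t, s \in `]0, T[ -> t \in `]0, T[ -> s <= t -> c <= m s -> c <= m t.
Proof.
move=> dmP dmge s t; rewrite !in_itv/= => /andP[s0 sT] /andP[t0 tT] st cs.
pose e r : R := expR (- K * r).
have de (r : R) : is_derive r 1 e (- K * e r).
  rewrite (_ : e = expR \o (- K \*: id)); last by apply/funext.
  apply: is_derive_eq; rewrite /GRing.scale/= mulr1 mulrC; congr (_ * _).
pose g := (m - cst c) * e.
have gE r : g r = (m r - c) * e r by [].
pose dg r : R := (dm r - K * (m r - c)) * e r.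
have dgP (r : R) : r \in `]0, T[ -> is_derive r 1 g (dg r).
  move=> /dmP dmr; have der := de r; apply: is_derive_eq.
  rewrite /dg !fctE /GRing.scale/=; ring.
have subr (r : R) : r \in `[s, t] -> r \in `]0, T[.
  by rewrite !in_itv/= => /andP[sr rt]; rewrite (lt_le_trans s0 sr) (le_lt_trans rt tT).
have dgst (r : R) : r \in `]s, t[ -> is_derive r 1 g (dg r).
  move=> rst; apply: dgP; apply: subr; exact: subset_itv_oo_cc rst.
have cg : {within `[s, t], continuous g}.
  apply: continuous_in_subspaceT => r /set_mem rst.
  have [dgr _] := dgP r (subr r rst).
  by apply: differentiable_continuous; apply/derivable1_diffP.
have [r rst E] := MVT_segment st dgst cg.
have : 0 <= dg r by rewrite mulr_ge0 ?expR_ge0// subr_ge0 dmge// subr.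
move=> dg0; have : 0 <= g t.
  rewrite -(subrK (g s) (g t)) E addr_ge0//.
    by rewrite mulr_ge0// subr_ge0.
  by rewrite gE mulr_ge0 ?expR_ge0// subr_ge0.
by rewrite gE pmulr_lge0 ?expR_gt0// subr_ge0.
Qed.

Variables (n : nat) (T : R) (u : R -> 'rV[R]_n -> R).
Hypothesis u_C12 : C12 T u.

(** Differentiation under the integral: the time derivative is continuous, hence bounded by a
    constant on [[t/2, (t+T)/2]] times the cube, a compact set within the open strip, and [bump_rV]
    is at most 1 there. *)
Lemma is_derive_moment k (t : R) : 0 < k -> t \in `]0, T[ ->
  is_derive t 1
    (fun s => \int[lebesgue_rV n]_(x in box 0 k^-1) (u s x * bump_rV k x))
    (\int[lebesgue_rV n]_(x in box 0 k^-1) ('D_1 (u ^~ x) t * bump_rV k x)).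
Proof.
move=> k0 tT; have [[du _ _] [cu cdu _ _]] := u_C12.
pose h (z : R * 'rV[R]_n) := 'D_1 (u ^~ z.2) z.1.
have t0T : 0 < t / 2 < t /\ t < (t + T) / 2 < T.
  by move: tT; rewrite in_itv/= => /andP[t0 tT]; split; apply/andP; split; lra.
have [/andP[a0 at0] /andP[tb bT]] := t0T.
set a := t / 2 in a0 at0; set b := (t + T) / 2 in tb bT.
have sub (s : R) : s \in `[a, b] -> s \in `]0, T[.
  by rewrite !in_itv/= => /andP[sr rt]; rewrite (lt_le_trans a0 sr) (le_lt_trans rt bT).
have subo (s : R) : s \in `]a, b[ -> s \in `]0, T[.
  by move=> sab; apply: sub; exact: subset_itv_oo_cc sab.
have [M M0 hM] : exists2 M, 0 <= M &
    forall z, (`[a, b]%classic `*` box 0 k^-1) z -> `|h z| <= M.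
  apply: compact_norm_bounded.
    by apply: compact_setX; [exact: segment_compact|exact: compact_box].
  by move=> [s x] /set_mem[/= /sub sT _]; exact: cdu.
have mB := @measurable_box R n 0 k^-1.
pose f s x := u s x * bump_rV k x.
have df s x : s \in `]0, T[ ->
    is_derive (s : R) 1 (f ^~ x) ('D_1 (u ^~ x) s * bump_rV k x).
  move=> sT; have d1 : is_derive (s : R) 1 (u ^~ x) ('D_1 (u ^~ x) s).
    by apply: derivableP; exact: du.
  rewrite (_ : f ^~ x = (u ^~ x) * cst (bump_rV k x)); last by apply/funext.
  by apply: is_derive_eq; rewrite scaler0 add0r /GRing.scale/= mulrC.
have intf s : `]a, b[%classic s ->
    (lebesgue_rV n).-integrable (box 0 k^-1) (EFin \o f s).
  move=> /= /subo sT; apply: integrable_box => x.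
  apply: continuousM; last exact: continuous_bump_rV.
  exact: (continuous_at_pairr (cu _ _ sT)).
have tab : `]a, b[%classic t by rewrite /= in_itv/= at0.
have derf s x : `]a, b[%classic s -> box 0 k^-1 x -> derivable (f ^~ x) s 1.
  by move=> /= /subo sT _; case: (df s x sT).
have intG : (lebesgue_rV n).-integrable (box 0 k^-1) (EFin \o cst M).
  by apply: integrable_box; exact: cst_continuous.
have G_ub s x : `]a, b[%classic s -> box 0 k^-1 x -> `|partial1of2 f s x| <= cst M x.
  move=> /= sab xB; have dfs := df s x (subo _ sab).
  rewrite partial1of2E derive_val normrM (ger0_norm (bump_rV_ge0 _ _)).
  apply: (@le_trans _ _ (M * 1)); last by rewrite mulr1.
  rewrite ler_pM// ?bump_rV_ge0 ?bump_rV_le1//; apply: (hM (s, x)); split => //=.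
  exact: subset_itv_oo_cc sab.
apply: DeriveDef.
  exact: (derivable_under_integral mB tab intf derf (fun=> M0) intG G_ub).
rewrite -derive1E (differentiation_under_integral mB tab intf derf (fun=> M0) intG G_ub).
apply: eq_Rintegral => x _; rewrite partial1of2E.
by have := df t x tT => dft; rewrite derive_val.
Qed.

End evolution.

(** * Growth of the nonlinearity *)

Section absorption.
Context {R : realType}.

Lemma exp_lower_bound (f : R -> R) (lambda p : R) :
  (0 < limf_einf (fun eta : R => (f eta * expR (- lambda * eta `^ p))%:E)
    (pinfty_nbhs R))%E ->
  exists c M : R, 0 < c /\
    forall eta, M < eta -> c * expR (lambda * eta `^ p) <= f eta.
Proof.
rewrite limf_einfE => /ereal_sup_gt[_ [V [M [_ MV]] <-]] inf0.
have [c c0 cV] : exists2 c : R, 0 < c & (c%:E <= ereal_inf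
    [set (f eta * expR (- lambda * eta `^ p))%:E | eta in V])%E.
  (* Were the infimum [+oo], any positive constant would do. *)
  move: inf0; case: (ereal_inf _) => [r r0|_|//]; first by exists r.
  by exists 1 => //; rewrite leey.
exists c, M; split => // eta /MV Veta.
have : (c%:E <= (f eta * expR (- lambda * eta `^ p))%:E)%E.
  by apply: (le_trans cV); apply: ereal_inf_lbound; exists eta.
by rewrite lee_fin mulNr expRN ler_pdivlMr ?expR_gt0.
Qed.

(** For [x <= eta] the linear bound is nonpositive. Beyond [eta], [exp (lambda x^p)] splits into two
    equal factors: one is at least [k^2], the other outgrows a multiple of [x] independent of [k].
    The bound [B] will be a bound on the solution. *)
Lemma superlinear_above (f : R -> R) (lambda p : R) (n : nat) (B : R) :
  (forall x, 0 <= x -> 0 <= f x) -> 0 < lambda -> 1 < p ->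
  (0 < limf_einf (fun eta : R => (f eta * expR (- lambda * eta `^ p))%:E)
    (pinfty_nbhs R))%E ->
  exists k eta : R,
    [/\ 1 <= k, 0 < eta, B <= eta, eta = (4 / lambda * ln k) `^ p^-1 &
      forall x, 0 <= x -> 2 * (n%:R * (18 * k ^+ 2 + 1)) * (x - eta) <= f x].
Proof.
move=> f_ge0 l0 p1 /exp_lower_bound[c [M [c0 fM]]].
have p0 : 0 < p by exact: lt_trans p1.
(* [E] is the future [eta]. Here [304 = 8 * 38]: for [x > E] the last entry gives
   [38 n x <= c lambda^2 x^2 / 8]. *)
pose E := Num.max (Num.max 1 B) (Num.max (M + 1) (304 * n%:R / (c * lambda ^+ 2))).
have [E1 BE ME nE] : [/\ 1 <= E, B <= E, M < E & 304 * n%:R / (c * lambda ^+ 2) <= E].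
  have : M < M + 1 by rewrite ltrDl.
  by move=> MM; split; rewrite /E ?le_max ?lt_max ?lexx ?MM ?orbT.
have E0 : 0 < E by exact: lt_le_trans E1.
(* [k] is obtained by inverting [eta = (4 / lambda * ln k)^(1/p)], so
   [k^2 = exp (lambda E^p / 2)]. *)
pose k := expR (lambda / 4 * E `^ p).
have k1 : 1 <= k.
  by rewrite -[leLHS]expR0 ler_expR mulr_ge0 ?powR_ge0// divr_ge0// ltW.
exists k, E; split => //.
  rewrite /k expRK mulrA (_ : 4 / lambda * (lambda / 4) = 1); last first.
    by field; rewrite gt_eqF.
  by rewrite mul1r -powRrM mulfV ?gt_eqF// powRr1// ltW.
move=> x x0; set K := n%:R * _.
have K0 : 0 <= K by rewrite mulr_ge0// addr_ge0// mulr_ge0// sqr_ge0.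
have [xE|Ex] := leP x E.
  by rewrite (le_trans _ (f_ge0 _ x0))// mulr_ge0_le0 ?subr_le0// mulr_ge0.
have Mx : M < x by exact: lt_trans Ex.
apply: le_trans (fM x Mx).
have x1 : 1 <= x by rewrite (le_trans E1)// ltW.
have -> : expR (lambda * x `^ p) = expR (lambda / 2 * x `^ p) * expR (lambda / 2 * x `^ p).
  by rewrite -expRD; congr expR; field.
have e1 : k ^+ 2 <= expR (lambda / 2 * x `^ p).
  rewrite /k -expRM_natl ler_expR mulrA (_ : 2 * (lambda / 4) = lambda / 2); last by field.
  rewrite ler_pM2l ?divr_gt0//.
  by apply: ge0_ler_powR; rewrite ?nnegrE ?(ltW p0) ?(ltW E0)// ltW.
have e2 : 38 * n%:R * x <= c * expR (lambda / 2 * x `^ p).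
  (* The quadratic term of the exponential series, with [x <= x^p] because [x >= 1]. *)
  have h : (lambda / 2 * x) ^+ 2 / 2 <= expR (lambda / 2 * x `^ p).
    apply: (@le_trans _ _ (expR (lambda / 2 * x))).
      have lx : 0 <= lambda / 2 * x by rewrite mulr_ge0// divr_ge0// ltW.
      have := @expR_ge1Dxn R _ 1 lx; rewrite (_ : 2`! = 2)%N//; lra.
    rewrite ler_expR ler_pM2l ?divr_gt0//.
    by rewrite -[leLHS]powRr1//; apply: ler_powR => //; exact: ltW.
  apply: (@le_trans _ _ (c * ((lambda / 2 * x) ^+ 2 / 2))); last first.
    by rewrite ler_pM2l.
  have : 304 * n%:R <= x * (c * lambda ^+ 2).
    rewrite -ler_pdivrMr; last by rewrite mulr_gt0// exprn_gt0.
    by rewrite (le_trans nE)// ltW.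
  move=> h2; have := ler_wpM2r x0 h2.
  by rewrite exprMn; lra.
have k2 : 1 <= k ^+ 2 by rewrite exprn_ege1.
(* [38 = 2 (18 + 1)]: since [1 <= k^2], [2 K <= 38 n k^2]. *)
apply: (@le_trans _ _ (38 * n%:R * x * k ^+ 2)).
  have n0 : 0 <= n%:R :> R by [].
  apply: (@le_trans _ _ (2 * K * x)).
    by apply: ler_wpM2l; [rewrite mulr_ge0|rewrite gerBl ltW].
  have := ler_wpM2l (mulr_ge0 n0 x0) k2; rewrite /K; lra.
rewrite mulrA; apply: ler_pM => //; first by rewrite !mulr_ge0.
exact: sqr_ge0.
Qed.

Lemma Rintegral_bump_gt0 n (k : R) : 0 < k ->
  0 < \int[lebesgue_rV n]_(x in box 0 k^-1) bump_rV k x.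
Proof.
move=> k0; have mB := @measurable_box R n 0 k^-1.
have iB : (lebesgue_rV n).-integrable (box 0 k^-1) (EFin \o bump_rV k).
  by apply: integrable_box; exact: continuous_bump_rV.
(* On the concentric cube of half the side, [q = k x_i] lies in [[1/4, 3/4]]; then
   [q (1 - q) >= 1/10] and each factor of the bump is at least [1/100]. *)
pose a : R := (4 * k)^-1; pose b : R := 3 * (4 * k)^-1.
have a0 : 0 < a by rewrite invr_gt0 mulr_gt0.
have ab : a < b by rewrite /b -/a; lra.
have bk : b <= k^-1 by rewrite /b invfM; have : 0 < k^-1 by [rewrite invr_gt0]; lra.
have sub : @box R n a b `<=` box 0 k^-1.
  move=> x xab i; have := xab i; rewrite !in_itv/= => /andP[ax xb].
  by rewrite (le_trans (ltW a0) ax) (le_trans xb bk).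
have mS := @measurable_box R n a b.
rewrite -lte_fin /Rintegral fineK; last exact: integrable_fin_num.
apply: (@lt_le_trans _ _ (\int[lebesgue_rV n]_(x in box 0 k^-1) ((1 / 100) ^+ n * \1_(box a b) x)%:E)%E).
  rewrite (@integralZl_indic _ _ _ _ _ mB (fun=> box a b))//; last first.
    by rewrite ltNge exprn_ge0.
  rewrite integral_indic//= (setIidl sub) lebesgue_box ?(ltW ab)// -EFinM lte_fin.
  by rewrite mulr_gt0// exprn_gt0// subr_gt0.
apply: ge0_le_integral => //.
- by apply/measurable_EFinP; apply: measurable_funM => //; exact: measurable_indic.
- exact: measurable_int iB.
move=> x _; rewrite lee_fin indicE.
have [/set_mem xab|_] := boolP (x \in box a b); last first.
  by rewrite mulr0 bump_rV_ge0.
rewrite mulr1 -[n in _ ^+ n]card_ord -prodr_const; apply: ler_prod => i _.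
rewrite divr_ge0//=.
have := xab i; rewrite in_itv/= => /andP[ax xb].
have kx1 : 1 / 4 <= k * x ord0 i.
  by rewrite -(ler_pM2l k0) in ax; apply: le_trans ax; rewrite /a invfM mulrCA mulfV ?mulr1 ?gt_eqF//; lra.
have kx2 : k * x ord0 i <= 3 / 4.
  by rewrite -(ler_pM2l k0) in xb; apply: (le_trans xb); rewrite /b invfM mulrCA [k * _]mulrCA mulfV ?mulr1 ?gt_eqF//; lra.
rewrite /bumpR; move: (k * x ord0 i) kx1 kx2 => q q1 q2.
have : 1 / 10 <= q * (1 - q) by nra.
by move: (q * _) => r; nra.
Qed.

End absorption.

(** * Nonexistence *)

(** The bump cut off to the cube is an admissible test function. Its pairing with the datum is at
    least [3 eta I > 2 eta I], a strict inequality that passes to [u s] for small [s > 0]. *)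
Lemma weak_star_moment (R : realType) (n : nat) (lambda p T k : R)
    (u : R -> 'rV[R]_n -> R) :
  (0 < n)%N -> 0 < lambda -> 1 < p -> 0 < T -> 1 <= k ->
  0 < (4 / lambda * ln k) `^ p^-1 ->
  (forall t : R, t \in `]0, T[ -> continuous (u t)) ->
  weak_star_cvg0 p u (datum lambda p) ->
  exists2 s, s \in `]0, T[ &
    2 * (4 / lambda * ln k) `^ p^-1 *
      \int[lebesgue_rV n]_(x in box 0 k^-1) bump_rV k x <=
    \int[lebesgue_rV n]_(x in box 0 k^-1) (u s x * bump_rV k x).
Proof.
move=> n0 l0 p1 T0 k1; set eta := (4 / lambda * ln k) `^ p^-1 => eta0 cu wu.
have k0 : 0 < k by exact: lt_le_trans k1.
set I := \int[_]_(_ in _) _.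
have I0 : 0 < I by exact: Rintegral_bump_gt0.
have mB := @measurable_box R n 0 k^-1.
pose phi : 'rV[R]_n -> R := bump_rV k \_ (box 0 k^-1).
have Lphi : Lpsi_conj p phi.
  apply: Lpsi_conj_indic => //; first exact: lebesgue_box_lty.
    by apply: measurable_continuous_rV; exact: continuous_bump_rV.
  by move=> x xB; rewrite bump_rV_ge0 bump_rV_le1.
have restr (v : 'rV[R]_n -> R) : (\int[lebesgue_rV n]_x (v x * phi x)%:E =
    \int[lebesgue_rV n]_(x in box 0 k^-1) (v x * bump_rV k x)%:E)%E.
  rewrite [RHS]integral_mkcond; apply: eq_integral => x _.
  by rewrite /phi !patchE; case: ifPn => // _; rewrite mulr0.
have iB (v : 'rV[R]_n -> R) : continuous v ->
    (lebesgue_rV n).-integrable (box 0 k^-1) (EFin \o (fun x => v x * bump_rV k x)).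
  move=> cv; apply: integrable_box => x; apply: continuousM; first exact: cv.
  exact: continuous_bump_rV.
have lower : ((2 * eta * I)%:E < \int[lebesgue_rV n]_x (datum lambda p x * phi x)%:E)%E.
  apply: (@lt_le_trans _ _ (3 * eta * I)%:E).
    by rewrite lte_fin ltr_pM2r// ltr_pM2r// ltr_nat.
  rewrite -RintegralZl//; last by apply: integrable_box; exact: continuous_bump_rV.
  rewrite /Rintegral fineK; last first.
    by apply: integrable_fin_num => //; apply: (iB (cst (3 * eta))); exact: cst_continuous.
  rewrite -(restr (cst (3 * eta))).
  apply: le_nnintegral => x.
    rewrite lee_fin mulr_ge0 ?mulr_ge0 ?(ltW eta0)// /phi patchE.
    by case: ifPn => // _; exact: bump_rV_ge0.
  rewrite lee_fin /phi patchE; case: ifPn => [/set_mem xB|_]; last by rewrite !mulr0.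
  (* The lower bound on the datum holds in the open cube; on the faces the bump vanishes. *)
  have [/forallP xi|/forallPn[i]] := boolP [forall i, 0 < x ord0 i < k^-1].
    by rewrite ler_wpM2r ?bump_rV_ge0// datum_ge.
  have := xB i; rewrite in_itv/= => /andP[x0 xk].
  rewrite lt_neqAle x0 andbT lt_neqAle xk andbT negb_and !negbK => xi.
  rewrite (bump_rVE k i) (_ : bumpR k _ = 0) ?mul0r ?mulr0// /bumpR.
  by case/orP: xi => /eqP => [<-|->]; rewrite ?mulr0 ?mul0r ?mulfV ?gt_eqF// ?subrr ?mulr0 expr0n.
have near_gt : \forall s \near (0 : R)^'+,
    ((2 * eta * I)%:E < \int[lebesgue_rV n]_x (u s x * phi x)%:E)%E.
  exact: (wu _ Lphi _ (open_ereal_gt' lower)).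
near (0 : R)^'+ => s.
have us : ((2 * eta * I)%:E < \int[lebesgue_rV n]_x (u s x * phi x)%:E)%E by near: s.
have sT : s < T by near: s; exact: nbhs_right_lt.
have s0 : 0 < s by near: s; exact: nbhs_right_gt.
have sI : s \in `]0, T[ by rewrite in_itv/= s0.
exists s => //; move: us; rewrite restr => /ltW us.
rewrite -lee_fin /Rintegral fineK//; apply: integrable_fin_num => //.
exact/iB/cu.
Unshelve. all: by end_near. Qed.

Theorem theorem1p3 (R : realType) (d : nat) (d_ge1 : (1 <= d)%N)
    (f : R -> R) (f_cont : continuous f) (f0 : f 0 = 0)
    (f_ge0 : forall x, 0 <= x -> 0 <= f x)
    (lambda p : R) (lambda_gt0 : 0 < lambda) (p_gt1 : 1 < p)
    (f_liminf : (0 < limf_einf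
      (fun eta : R => (f eta * expR (- lambda * eta `^ p))%:E)
      (pinfty_nbhs R))%E) :
  exists u0 : 'rV[R]_d -> R,
    [/\ expL p u0,
        {ae lebesgue_rV d, forall x, 0 <= u0 x}
      & forall T, 0 < T ->
          ~ exists u : R -> 'rV[R]_d -> R,
              (forall t x, t \in `]0, T[ -> 0 <= u t x) /\
              expL_classical_solution f p T u0 u].
Proof.
exists (datum lambda p); split; first exact: expL_datum.
  by apply: aeW => x; exact: datum_ge0.
move=> T T0 [u [u_ge0 [_ _ uC12 u_eq u_weak]]].
have [[du dxu ddxu] [cu cdu cdxu cddxu]] := uC12.
have cont_u (t : R) : t \in `]0, T[ -> continuous (u t).
  by move=> tT x; exact: (continuous_at_pairr (cu _ _ tT)).
pose t1 := T / 2.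
have t1T : t1 \in `]0, T[ by rewrite in_itv/= /t1; apply/andP; split; lra.
(* The bound is taken on the unit cube, which contains every cube [[0, 1/k]^d] with [k >= 1], so
   that [M] is fixed before [k]. *)
have [M M0 uM] : exists2 M, 0 <= M & forall x, box 0 1 x -> `|u t1 x| <= M.
  apply: compact_norm_bounded; first exact: compact_box.
  by move=> x _; exact: cont_u.
have [k [eta [k1 eta0 Meta etaE f_super]]] :=
  superlinear_above d M f_ge0 lambda_gt0 p_gt1 f_liminf.
have k0 : 0 < k by exact: lt_le_trans k1.
have I0 := @Rintegral_bump_gt0 R d k k0.
set I := \int[_]_(_ in _) _ in I0.
pose m s := \int[lebesgue_rV d]_(x in box 0 k^-1) (u s x * bump_rV k x).
(* Working on []0, t1[] makes the starting time precede [t1]. *)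
have [s sT1 ms] : exists2 s, s \in `]0, t1[ & 2 * eta * I <= m s.
  rewrite etaE; apply: weak_star_moment => //; rewrite -?etaE//.
    by rewrite /t1 divr_gt0.
  move=> t; rewrite in_itv/= => /andP[t0 tt1]; apply: cont_u.
  by move: t1T; rewrite !in_itv/= t0 => /andP[_]; exact: lt_trans.
have [s0 st1] : 0 < s /\ s < t1 by move: sT1; rewrite in_itv/= => /andP[].
have sT : s \in `]0, T[.
  by move: t1T; rewrite !in_itv/= s0 => /andP[_]; exact: lt_trans.
have mt1 : 2 * eta * I <= m t1.
  apply: (@growth_ge R m (fun t => \int[lebesgue_rV d]_(x in box 0 k^-1)
    ('D_1 (u ^~ x) t * bump_rV k x)) T (d%:R * (18 * k ^+ 2 + 1)) _ _ _ s) => //.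
  - by move=> t tT; exact: (is_derive_moment uC12 k0 tT).
  - move=> t tT; apply: (@supersolution_moment_ge R d k eta (u t)
      (fun x => 'D_1 (u ^~ x) t)) => //.
    + by move=> x _; exact: u_ge0.
    + exact: cont_u.
    + by move=> x; exact: (continuous_at_pairr (cdu _ _ tT)).
    + by move=> x i; exact: dxu.
    + by move=> x i; exact: ddxu.
    + by move=> i x; exact: (continuous_at_pairr (cddxu i i _ _ tT)).
    + by move=> x _; rewrite u_eq// f_super// u_ge0.
  - exact: ltW.
have : m t1 <= M * I.
  have mB := @measurable_box R d 0 k^-1.
  have cb := @continuous_bump_rV R d k.
  rewrite /m /I -RintegralZl//; last exact: integrable_box.
  apply: le_Rintegral => //.
  - apply: integrable_box => x; apply: continuousM; [exact: cont_u|exact: cb].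
  - apply: integrable_box => x; apply: continuousM; [exact: cst_continuous|exact: cb].
  move=> x xB; rewrite ler_wpM2r ?bump_rV_ge0//.
  apply: (le_trans (ler_norm _)); apply: uM => i.
  have := xB i; rewrite !in_itv/= => /andP[-> /le_trans]; apply.
  by rewrite invf_le1.
(* Dividing by [I > 0] would give [2 eta <= M], against [M <= eta] and [eta > 0]. *)
move=> /(le_trans mt1); apply/negP; rewrite -ltNge ltr_pM2r//; lra.
Qed.
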